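(* Let $w$ be a one-dimensional standard Brownian motion, $\tilde\beta>0$, $\psi(\varepsilon)=(\log\log\log|\log\varepsilon|)^{\tilde\beta}$, $\tau(\varepsilon)=\inf\{t>0:w(t)\notin(-\psi(\varepsilon),\psi(\varepsilon))\}$, $W_\varepsilon(t)=w(t\wedge\tau(\varepsilon))$, and $$w^\varepsilon(t)=\int_0^\infty\eta_{\psi(\varepsilon)}(t-s)W_\varepsilon(s)ds,\qquad\eta_{\psi(\varepsilon)}(s)=\psi(\varepsilon)\eta(\psi(\varepsilon)s),$$ where $\eta\ge0$ is a $C^\infty$ function on $\mathbb R$ with support contained in $(0,1)$ and $\int_{\mathbb R}\eta(u)du=1$. Then $$|\dot w^\varepsilon|_{k,T}\le k\,|\eta|_{k+2}\,\psi(\varepsilon)^{k+2},\qquad k\in\mathbb Z_+=\{0,1,2,\dots\}.$$ In particular, with the choice $H_\varepsilon=n_1(K)|\eta|_{n_1(K)+2}\psi(\varepsilon)^{n_1(K)+2}$, the following condition holds for this $w^\varepsilon$: for every $T>0$, $H_\varepsilon\ge1$ ($0<\varepsilon\le1$) and $$\sup_{t\in[0,T],\,\omega\in\Omega}\Big|\frac{d^k}{dt^k}w^\varepsilon(t,\omega)\Big|\le H_\varepsilon,\quad k=1,2,\dots,n_1(K)+1,\qquad\lim_{\varepsilon\downarrow0}H_\varepsilon=\infty,\qquad\lim_{\varepsilon\downarrow0}\frac{H_\varepsilon^{2n_1(K)}}{\log\log|\log\varepsilon|}=0.$$ Moreover, for every $T>0$ and some $\theta\in(0,\frac12)$, $\lim_{\varepsilon\downarrow0}\|w^\varepsilon-w\|_{C^\theta([0,T])}=0$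 a.s.
   Context: $|g|_{k,T}=\sum_{i=0}^k\sup_{t\in[0,T]}|\frac{d^ig}{dt^i}(t)|$, $T>0$; $|\eta|_k=\sum_{i=0}^k\sup|\eta^{(i)}|$ is the same norm for $\eta$; $\|u\|_{C^\theta([0,T])}=\sup_{[0,T]}|u|+\sup_{s\ne t\in[0,T]}\frac{|u(t)-u(s)|}{|t-s|^\theta}$. $\Omega$ is the underlying probability space. $K$ is a fixed integer ($K>\max(n+2,6)$, $n$ the space dimension of the underlying problem) and $n_1(K)\in\mathbb N$ is a fixed positive integer determined from $K$.
   Formalization: The bounds and H_ε≥1 are stated only for ε in (0,1] with log log log|log ε|≥1, since ψ is undefined near ε=1 and H_ε→0 where ψ→0; for k=0 the printed bound 0 would force w^ε=0, so the factor k is replaced by 1 there. *)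

(* Defs.v *)
From HB Require Import structures.
From mathcomp Require Import all_boot all_order all_algebra.
From mathcomp Require Import all_classical all_reals all_analysis.
Set Implicit Arguments.
Unset Strict Implicit.
Unset Printing Implicit Defensive.
Import Order.TTheory GRing.Theory Num.Theory.
Import numFieldNormedType.Exports.
Local Open Scope classical_set_scope.
Local Open Scope ring_scope.

(** Norms take values in [\bar R], so that suprema of unbounded sets are [+oo]
    rather than a default value. *)

(** [f^`(i)] is a default value where [f] is not differentiable, so bounds on
    derivatives are meaningful only together with [smooth]. *)
Definition smooth (R : realType) (f : R -> R) : Prop :=
  forall (i : nat) (x : R), derivable (f^`(i))%classic x 1.

(** [|g|_{k,T}] is [Ck_norm `[0, T] k g] and [|eta|_k] is [Ck_norm setT k eta]. *)
Definition Ck_norm (R : realType) (D : set R) (k : nat) (g : R -> R) : \bar R :=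
  (\sum_(i < k.+1) ereal_sup [set `|(g^`(i))%classic t|%R%:E | t in D])%E.

Definition holder_norm (R : realType) (theta T : R) (u : R -> R) : \bar R :=
  (ereal_sup [set `|u t|%R%:E | t in `[0%R, T]] +
   ereal_sup [set (`|u p.1 - u p.2| / `|p.1 - p.2| `^ theta)%R%:E | p in
     [set p : R * R | [/\ `[0%R, T]%classic p.1, `[0%R, T]%classic p.2
                        & p.1 != p.2]]])%E.

(** Only the times [t >= 0] matter. The second parameter of [normal_prob] is
    the standard deviation. Taking some of the sets [A i] to be [setT], the last
    clause is the mutual independence of the increments. *)
Definition brownian_motion (R : realType) (d : measure_display)
    (Omega : measurableType d) (P : probability Omega R)
    (w : R -> {RV P >-> R}) : Prop :=
  [/\ forall omega : Omega, w 0 omega = 0,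
      forall omega : Omega,
        {within `[0, +oo[, continuous (fun t : R => w t omega)},
      forall s t : R, 0 <= s -> s < t ->
        forall A : set R, measurable A ->
          P [set omega | A (w t omega - w s omega)] =
          normal_prob 0 (Num.sqrt (t - s)) A
    & forall (m : nat) (t : nat -> R), 0 <= t 0%N ->
        (forall i : nat, (i < m)%N -> t i <= t i.+1) ->
        forall A : nat -> set R, (forall i : nat, measurable (A i)) ->
          P [set omega | forall i : nat, (i < m)%N ->
                           A i (w (t i.+1) omega - w (t i) omega)] =
          (\prod_(i < m)
             P [set omega | A i (w (t i.+1) omega - w (t i) omega)%R])%E].

Definition log3 (R : realType) (eps : R) : R := ln (ln (ln `|ln eps|)).

(** Small values of [eps] only: the iterated logarithms are undefined for [eps]
    near 1 ([ln x] is [0] for [x <= 0]), and for [0 < log3 eps < 1] the power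
    [psi] tends to [0] with [log3 eps], so that bounds which need [psi >= 1]
    fail. *)
Definition small_eps (R : realType) (eps : R) : Prop :=
  0 < eps <= 1 /\ 1 <= log3 eps.

Definition psi (R : realType) (beta eps : R) : R := log3 eps `^ beta.

(** [+oo] when [x] never leaves [(-c, c)]. *)
Definition exit_time (R : realType) (c : R) (x : R -> R) : \bar R :=
  ereal_inf [set t%:E | t in [set t : R | 0 < t /\ ~ (- c < x t < c)]].

Definition stopped (R : realType) (c : R) (x : R -> R) (t : R) : R :=
  x (fine (mine t%:E (exit_time c x))).

Definition eta_scaled (R : realType) (eta : R -> R) (c s : R) : R :=
  c * eta (c * s).

Definition w_eps (R : realType) (beta : R) (eta : R -> R) (x : R -> R)
    (eps t : R) : R :=
  \int[lebesgue_measure]_(s in `[0, +oo[)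
    (eta_scaled eta (psi beta eps) (t - s) * stopped (psi beta eps) x s).

(** [H_eps] is the case [k = n_1(K)]. The norm of [eta] is finite for a smooth
    [eta] with compact support. *)
Definition psi_bound (R : realType) (beta : R) (eta : R -> R) (k : nat)
    (eps : R) : R :=
  k%:R * fine (Ck_norm setT k.+2 eta) * psi beta eps ^+ k.+2.

(* Main.v *)
(** The mollified path is a convolution: all derivatives fall on the kernel
    [c * eta (c * s)], [c = psi eps], whose [i]-th derivative is
    [c ^ i.+1 * eta^`(i) (c * s)], supported in an interval of length [1 / c],
    while the stopped path is bounded by [c]. Hence the [i]-th derivative of
    [w^eps] is at most [c ^ i.+1 * sup |eta^`(i)|], which gives the bounds; the
    limits hold because [H_eps] is polynomial in a power of [log3 eps] whereas
    [log log |log eps| = exp (log3 eps)].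

    For the convergence, Brownian paths are almost surely [1/8]-Hoelder on
    [[0, T]]: Gaussian tails and Borel-Cantelli control the dyadic increments,
    and chaining does the rest. Once [psi eps] exceeds the maximum of the path
    on [[0, T]], the stopping is invisible there, so [w^eps t] is the average of
    [w (t - u / c)] against [eta u]. Both the difference [w^eps - w] and its
    increments are then small, and interpolating between the bounds
    [c ^ - g] and [|t - s| ^ g] gives convergence in every smaller exponent. *)

Require Import Defs.
From mathcomp Require Import all_boot all_order all_algebra.
From mathcomp Require Import all_classical all_reals all_analysis.
From mathcomp Require Import measurable_realfun ring lra.
Import Order.TTheory GRing.Theory Num.Theory.
Import numFieldNormedType.Exports.
Local Open Scope classical_set_scope.
Local Open Scope ring_scope.

Set Implicit Arguments.
Unset Strict Implicit.
Unset Printing Implicit Defensive.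

(** * Convolution with a compactly supported kernel *)

Section calculus.
Context {R : realType}.
Implicit Types (f phi Y : R -> R) (t x a b r A M : R).

Local Notation mu := (@lebesgue_measure R).

Lemma derivable1_continuous f : (forall x, derivable f x 1) -> continuous f.
Proof. by move=> df x; apply/differentiable_continuous/derivable1_diffP. Qed.

(** The complement of [S] is open, so near a point outside [S] every derivative is that of a locally
    zero function. *)
Lemma derive1n_eq0_notin f (S : set R) : closed S ->
  (forall x, ~ S x -> f x = 0) ->
  forall i x, ~ S x -> derive1n i f x = 0.
Proof.
move=> cS f0; elim=> [|i IH] x Sx; first exact: f0.
rewrite derive1nS derive1E.
have -> : 'D_1 (derive1n i f) x = 'D_1 (cst 0 : R -> R) x.
  apply: near_eq_derive.
  have : nbhs x (~` S) by apply: open_nbhs_nbhs; split => //; exact: closed_openC.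
  by apply: filterS => y; exact: IH.
exact: derive_cst.
Qed.

Lemma bounded_of_support f a b : a <= b -> continuous f ->
  (forall x, x \notin `]a, b[ -> f x = 0) ->
  exists2 A : R, 0 <= A & forall x, `|f x| <= A.
Proof.
move=> ab cf f0.
have : {within `[a, b], continuous (fun x => `|f x|)}.
  apply: continuous_subspaceT => x.
  exact: (continuous_comp (cf x) (@norm_continuous _ R^o _)).
move=> /(EVT_max ab)[c _ Hc]; exists `|f c| => // x.
have [xab|xab] := boolP (x \in `]a, b[); last by rewrite f0// normr0.
by apply: Hc; exact: subset_itv_oo_cc.
Qed.

(** Integrating over the whole line leaves [conv_restrict] free to choose the domain: a window
    moving with [t] for estimates, a fixed one for differentiation. *)
Definition conv phi Y t : R := \int[mu]_s (phi (t - s) * Y s).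

Lemma conv_restrict phi Y t (D : set R) :
  (forall s, ~ D s -> phi (t - s) * Y s = 0) ->
  conv phi Y t = \int[mu]_(s in D) (phi (t - s) * Y s).
Proof.
move=> D0; rewrite /conv [in RHS]Rintegral_mkcond; congr Rintegral.
apply/funext => s; rewrite patchE; case: ifPn => // /negP sD.
by rewrite D0// => Ds; apply: sD; rewrite inE.
Qed.

Lemma conv_itv phi Y a t : (forall x, x \notin `]0, a[ -> phi x = 0) ->
  conv phi Y t = \int[mu]_(s in `[t - a, t]) (phi (t - s) * Y s).
Proof.
move=> phi0; apply: conv_restrict => s /= /negP sat.
rewrite phi0 ?mul0r//; apply: contra sat; rewrite !in_itv/= => /andP[? ?].
by apply/andP; split; lra.
Qed.

Lemma continuous_subl phi t : continuous phi -> continuous (fun s => phi (t - s)).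
Proof.
move=> cphi s; apply: (@continuous_comp _ _ _ (fun s => t - s) phi); last exact: cphi.
by apply: (@cvgB _ R^o); [exact: cvg_cst|exact: cvg_id].
Qed.

Lemma continuous_conv_integrand phi Y t : continuous phi -> continuous Y ->
  continuous (fun s => phi (t - s) * Y s).
Proof.
by move=> cphi cY s; apply: cvgM; [exact: continuous_subl|exact: cY].
Qed.

Lemma continuous_itv_integrable f a b : continuous f ->
  mu.-integrable `[a, b] (EFin \o f).
Proof.
move=> cf; apply: continuous_compact_integrable; first exact: segment_compact.
exact: continuous_subspaceT.
Qed.

Lemma Rintegral_itv_cst a b r : a <= b ->
  \int[mu]_(s in `[a, b]) r = r * (b - a).
Proof.
move=> ab; rewrite Rintegral_cst//= lebesgue_measure_itv/= lte_fin.
by move: ab; rewrite le_eqVlt => /predU1P[->|->//]; rewrite ltxx subrr.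
Qed.

(** The integrand lives on a window of length [a] and is at most [A * M] there. *)
Lemma conv_bound phi Y a A M t : 0 <= a -> continuous phi -> continuous Y ->
  (forall x, x \notin `]0, a[ -> phi x = 0) ->
  (forall x, `|phi x| <= A) -> (forall x, `|Y x| <= M) ->
  `|conv phi Y t| <= A * M * a.
Proof.
move=> a0 cphi cY phi0 phiA YM; rewrite (conv_itv _ _ phi0).
have cf := @continuous_conv_integrand phi Y t cphi cY.
apply: (le_trans (le_normr_Rintegral _ _)) => //.
  exact: continuous_itv_integrable.
have -> : A * M * a = \int[mu]_(s in `[t - a, t]) (A * M).
  by rewrite Rintegral_itv_cst ?subKr// lerBlDr lerDl.
apply: le_Rintegral => //.
- apply: (continuous_itv_integrable (f := fun s => `|phi (t - s) * Y s|)) => s.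
  exact: (continuous_comp (cf s) (@norm_continuous _ R^o _)).
- by apply: (continuous_itv_integrable (f := fun=> A * M)); exact: cst_continuous.
- by move=> s _; rewrite normrM ler_pM.
Qed.

Lemma is_derive_subr phi s x : derivable phi (x - s) 1 ->
  is_derive x 1 (fun z => phi (z - s)) ((phi^`())%classic (x - s)).
Proof.
move=> dphi.
have H1 : is_derive x (1:R) (fun z : R => z - s) 1.
  have := is_deriveB (is_derive_id x (1:R)) (is_derive_cst s x (1:R)).
  by rewrite subr0.
have H2 : is_derive (x - s) (1:R) phi (phi^`()%classic (x - s)).
  by apply: DeriveDef => //; rewrite derive1E.
have := @is_derive1_comp _ phi (fun z => z - s) x _ _ H2 H1.
by rewrite mulr1.
Qed.

(** Differentiation under the integral sign, with dominating function [A * |Y s|]; the derivative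
    falls on the kernel, so continuity of [Y] suffices. *)
Lemma is_derive_conv phi Y a t : 0 <= a -> continuous Y ->
  (forall x, derivable phi x 1) -> continuous (phi^`())%classic ->
  (forall x, x \notin `]0, a[ -> phi x = 0) ->
  (forall x, x \notin `]0, a[ -> (phi^`())%classic x = 0) ->
  is_derive t 1 (conv phi Y) (conv (phi^`())%classic Y t).
Proof.
move=> a0 cY dphi cdphi phi0 dphi0.
have cphi := derivable1_continuous dphi.
have [A A0 HA] := bounded_of_support a0 cdphi dphi0.
(* One domain must serve all [x] near [t]: [B] contains [[x - a, x]] whenever [|x - t| < 1]. *)
set B := `[t - 1 - a, t + 1]%classic.
have convB psi x : (forall z, z \notin `]0, a[ -> psi z = 0) -> x \in `]t - 1, t + 1[ ->
    conv psi Y x = \int[mu]_(s in B) (psi (x - s) * Y s).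
  move=> psi0; rewrite in_itv/= => /andP[? ?]; apply: conv_restrict => s.
  rewrite /B/= => /negP; rewrite in_itv/= => sB; rewrite psi0 ?mul0r//.
  apply: contra sB; rewrite in_itv/= => /andP[? ?]; apply/andP; split; lra.
have tI : `]t - 1, t + 1[%classic t.
  by rewrite /= in_itv/=; apply/andP; split; lra.
have d1 x s : is_derive x 1 (fun z => phi (z - s) * Y s) ((phi^`())%classic (x - s) * Y s).
  have := is_derive_subr (dphi (x - s)) => H.
  have := @is_deriveM _ _ (fun z => phi (z - s)) (cst (Y s)) x 1 _ _ H (is_derive_cst _ _ _).
  by rewrite scaler0 add0r /= [Y s *: _]mulrC.
have p12 x s : partial1of2 (fun x s => phi (x - s) * Y s) x s = (phi^`())%classic (x - s) * Y s.
  by rewrite partial1of2E; have [_ <-] := d1 x s.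
pose f x s := phi (x - s) * Y s.
have intf x : `]t - 1, t + 1[%classic x -> mu.-integrable B (EFin \o f x).
  by move=> _; apply: continuous_itv_integrable; exact: continuous_conv_integrand.
have derf x s : `]t - 1, t + 1[%classic x -> B s -> derivable (f ^~ s) x 1.
  by move=> _ _; have [] := d1 x s.
have G0 s : 0 <= A * `|Y s| by rewrite mulr_ge0.
have intG : mu.-integrable B (EFin \o (fun s => A * `|Y s|)).
  apply: continuous_itv_integrable => s; apply: cvgM; first exact: cst_continuous.
  exact: (continuous_comp (cY s) (@norm_continuous _ R^o _)).
have GU x s : `]t - 1, t + 1[%classic x -> B s -> `|partial1of2 f x s| <= A * `|Y s|.
  by move=> _ _; rewrite p12 normrM ler_wpM2r.
have mB : measurable (B : set (measurableTypeR R)) by exact: measurable_itv.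
have Ht : {near t, conv phi Y =1 (fun x => \int[mu]_(s in B) f x s)}.
  near=> x; apply: convB => //.
  near: x; apply: near_in_itvoo; exact: tI.
have Dt := derivable_under_integral mB tI intf derf G0 intG GU.
have Vt := differentiation_under_integral mB tI intf derf G0 intG GU.
apply: DeriveDef.
  by apply: near_eq_derivable Dt; apply: filterS Ht => x ->.
rewrite (near_eq_derive _ Ht) -derive1E Vt convB//.
by apply: eq_Rintegral => s _; rewrite p12.
Unshelve. all: by end_near. Qed.

End calculus.

(** * Stopped paths *)

Section stopping.
Context {R : realType}.
Implicit Types (x : R -> R) (c r s t u v : R).

(** Freezing the path at [x 0] for negative times turns continuity within the half-line into
    continuity on the whole line, as the convolution lemmas require. *)
Lemma continuous_maxr0 x : {within `[0, +oo[, continuous x} ->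
  continuous (fun s => x (Num.max s 0)).
Proof.
move=> /continuous_within_itvcyP[cx c0] s.
have cm : continuous (fun s : R => Num.max s 0).
  by apply: max_fun_continuous; [move=> ?; exact: cvg_id|exact: cst_continuous].
have [s0|s0|s0] := ltgtP s 0.
- have : {near s, (fun=> x 0) =1 (fun s => x (Num.max s 0))}.
    near=> z; rewrite max_r//; apply: ltW; near: z; exact: lt_nbhsl.
  move=> /near_eq_cvg/cvg_trans; apply.
  by rewrite /= max_r 1?ltW//; exact: cvg_cst.
- have ms : Num.max s 0 = s by rewrite max_l// ltW.
  apply: (@continuous_comp _ _ _ (fun s => Num.max s 0) x); first exact: cm.
  by rewrite ms; apply: cx; rewrite in_itv/= s0.
- apply/cvgrPdist_lt => /= e e0; rewrite s0 maxxx.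
  move/cvgrPdist_lt : c0 => /(_ _ e0)[d /= d0 H].
  exists d => //= z; rewrite /ball_/= sub0r normrN => zd /=.
  have [z0|z0] := leP z 0; first by rewrite subrr normr0.
  by apply: H => //=; rewrite sub0r normrN.
Unshelve. all: by end_near. Qed.

Lemma exit_time_ge0 c x : (0%:E <= exit_time c x)%E.
Proof. by apply: le_ereal_inf_tmp => _ [t [t0 _] <-]; rewrite lee_fin ltW. Qed.

Lemma lt_exit_time c x t : 0 < t -> (t%:E < exit_time c x)%E -> `|x t| < c.
Proof.
move=> t0 tE; rewrite ltr_norml; apply/negP => xt; move: tE; rewrite ltNge => /negP; apply.
by apply: ereal_inf_lbound => /=; exists t => //; split => //; exact/negP.
Qed.

Lemma le_exit_time c x t : (forall s, 0 < s -> s <= t -> `|x s| < c) ->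
  (t%:E <= exit_time c x)%E.
Proof.
move=> xc; apply: le_ereal_inf_tmp => _ [s [s0 sc] <-]; rewrite lee_fin leNgt.
by apply/negP => /ltW st; apply: sc; rewrite -ltr_norml xc.
Qed.

Lemma stopped_id c x t : (t%:E <= exit_time c x)%E -> stopped c x t = x t.
Proof. by move=> tE; rewrite /stopped min_l. Qed.

Section bounded.
Variables (c : R) (x : R -> R).
Hypotheses (c_gt0 : 0 < c) (x0 : x 0 = 0).
Hypothesis cx : {within `[0, +oo[, continuous x}.

(** Before the exit time the bound is strict; by continuity it survives, no longer strictly, at the
    exit time itself. *)
Lemma norm_le_exit_time u : 0 <= u -> (u%:E <= exit_time c x)%E -> `|x u| <= c.
Proof.
rewrite le_eqVlt => /predU1P[<- _|u0 uE]; first by rewrite x0 normr0 ltW.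
rewrite leNgt; apply/negP => xu.
have cx' := continuous_maxr0 cx.
have : `|x (Num.max v 0)| @[v --> u] --> `|x u|.
  have := continuous_comp (cx' u) (@norm_continuous _ R^o _).
  by rewrite /prop_for/= {1}/continuous_at/= (max_l (ltW u0)).
move=> /cvgr_gt /(_ _ xu)[e /= e0 H].
(* A time before [u], within [e] of it so that [|x v| > c], and kept positive by [u / 2]; it
   contradicts [lt_exit_time]. *)
pose v := Num.max (u - e / 2) (u / 2).
have vu : v < u by rewrite gt_max; apply/andP; split; lra.
have v0 : 0 < v by rewrite lt_max; apply/orP; right; lra.
have : ball_ Num.norm u e v.
  rewrite /ball_/= gtr0_norm ?subr_gt0// ltrBlDr -ltrBlDl.
  by rewrite lt_max; apply/orP; left; lra.
move=> /H /=; rewrite max_l 1?ltW//.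
by rewrite ltNge ltW// lt_exit_time// (lt_le_trans _ uE)// lte_fin.
Qed.

Lemma stopped_maxr0 : [/\ continuous (fun s => stopped c x (Num.max s 0)),
  forall s, `|stopped c x (Num.max s 0)| <= c &
  forall s, s <= 0 -> stopped c x (Num.max s 0) = 0].
Proof.
have cx' := continuous_maxr0 cx.
have E0 := exit_time_ge0 c x.
split.
- case E : (exit_time c x) E0 => [r| |]// r0.
  (* A finite exit time [r] truncates time at [r], a continuous operation; with exit time [+oo]
     nothing is stopped. *)
  + have -> : (fun s => stopped c x (Num.max s 0)) =
        (fun s => x (Num.max s 0)) \o (fun s => Num.min (Num.max s 0) r).
      apply/funext => s; rewrite /stopped E -EFin_min/=; congr (x _).
      by rewrite [RHS]max_l// le_min le_max lexx orbT/= -lee_fin.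
    move=> s; apply: continuous_comp; last exact: cx'.
    apply: min_fun_continuous; last exact: cst_continuous.
    by apply: max_fun_continuous; [move=> ?; exact: cvg_id|exact: cst_continuous].
  + have -> // : (fun s => stopped c x (Num.max s 0)) = (fun s => x (Num.max s 0)).
    by apply/funext => s; rewrite stopped_id// E leey.
- move=> s; have ms0 : 0 <= Num.max s 0 by rewrite le_max lexx orbT.
  have mE : (0 <= mine (Num.max s 0)%:E (exit_time c x))%E by rewrite le_min lee_fin ms0.
  (* The minimum with a real number is finite even if the path never exits, so [fine] returns no
     default value. *)
  have mfin : mine (Num.max s 0)%:E (exit_time c x) \is a fin_num.
    by rewrite ge0_fin_numE// gt_min ltry.
  rewrite /stopped; apply: norm_le_exit_time; first exact: fine_ge0.
  by rewrite fineK// ge_min lexx orbT.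
- move=> s s0; rewrite max_r// stopped_id//.
Qed.

End bounded.

(** For [s < 0] the extended stopped path equals [x 0 = 0], so the integral over the half-line is
    one over the whole line. *)
Lemma w_eps_conv beta (eta : R -> R) x eps : x 0 = 0 ->
  w_eps beta eta x eps =
  conv (eta_scaled eta (psi beta eps))
       (fun s => stopped (psi beta eps) x (Num.max s 0)).
Proof.
move=> x0; apply/funext => t; rewrite /w_eps.
rewrite (@conv_restrict _ _ _ _ `[0, +oo[%classic).
  apply: eq_Rintegral => s; rewrite inE/= in_itv/= andbT => s0.
  by rewrite max_l.
move=> s /=; rewrite in_itv/= andbT => /negP; rewrite -ltNge => s0.
rewrite max_r 1?ltW// stopped_id ?x0 ?mulr0//; exact: exit_time_ge0.
Qed.

End stopping.

(** * Derivatives of the mollified path *)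

Section mollifier.
Context {R : realType}.
Implicit Types (phi Y eta : R -> R) (c t x a : R).

Lemma continuous_derive1n phi i : smooth phi -> continuous (derive1n i phi).
Proof. by move=> sphi; apply: derivable1_continuous => x; exact: sphi. Qed.

(** Induction with [is_derive_conv]: each [derive1n i phi] is again a smooth kernel vanishing off
    the same interval. *)
Lemma derive1n_conv phi Y a : 0 <= a -> continuous Y -> smooth phi ->
  (forall i x, x \notin `]0, a[ -> derive1n i phi x = 0) ->
  forall i, derive1n i (conv phi Y) = conv (derive1n i phi) Y.
Proof.
move=> a0 cY sphi phi0; elim=> [//|i IH].
rewrite !derive1nS IH; apply/funext => t; rewrite derive1E.
apply: derive_val; apply: (@is_derive_conv _ _ _ a) => //.
- by rewrite -derive1nS; exact: continuous_derive1n.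
- by move=> z; exact: (phi0 i z).
- by move=> z; rewrite -derive1nS; exact: (phi0 i.+1 z).
Qed.

Lemma smooth_conv phi Y a : 0 <= a -> continuous Y -> smooth phi ->
  (forall i x, x \notin `]0, a[ -> derive1n i phi x = 0) ->
  smooth (conv phi Y).
Proof.
move=> a0 cY sphi phi0 i x; rewrite (derive1n_conv a0)//.
have [] := @is_derive_conv _ (derive1n i phi) Y a x => //.
- by rewrite -derive1nS; exact: continuous_derive1n.
- by move=> z; exact: (phi0 i z).
- by move=> z; rewrite -derive1nS; exact: (phi0 i.+1 z).
Qed.

Lemma is_derive_scaled phi c k x : (forall z, derivable phi z 1) ->
  is_derive x 1 (fun s => k * phi (c * s)) (k * c * (phi^`())%classic (c * x)).
Proof.
move=> dphi.
have H1 : is_derive x (1:R) (fun z : R => c * z) c.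
  have := is_deriveM (is_derive_cst c x (1:R)) (is_derive_id x (1:R)).
  by rewrite scaler0 addr0 /= -[c *: 1]/(c * 1) mulr1.
have H2 : is_derive (c * x) (1:R) phi (phi^`()%classic (c * x)).
  by apply: DeriveDef => //; rewrite derive1E.
have H3 := @is_derive1_comp _ phi (fun z => c * z) x _ _ H2 H1.
have := is_deriveM (is_derive_cst k x (1:R)) H3.
rewrite scaler0 addr0 /= -mulrA => H; rewrite (mulrC c); exact: H.
Qed.

(** One factor [c] is the normalization of the kernel; the chain rule adds one per derivative. *)
Lemma derive1n_eta_scaled eta c i : smooth eta ->
  derive1n i (eta_scaled eta c) = fun s => c ^+ i.+1 * derive1n i eta (c * s).
Proof.
move=> seta; elim: i => [|i IH]; first by [].
rewrite derive1nS IH; apply/funext => s; rewrite derive1E [in RHS]exprSr.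
by rewrite derive1nS; apply: derive_val; apply: is_derive_scaled; exact: seta.
Qed.

Lemma smooth_eta_scaled eta c : smooth eta -> smooth (eta_scaled eta c).
Proof.
move=> seta i x; rewrite derive1n_eta_scaled//.
by have [] := @is_derive_scaled (derive1n i eta) c (c ^+ i.+1) x (seta i).
Qed.

Section eta.
Variable eta : R -> R.
Hypothesis eta_ge0 : forall x : R, 0 <= eta x.
Hypothesis eta_smooth : smooth eta.
Hypothesis eta_supp : closure [set x : R | eta x != 0] `<=` `]0, 1[.
Hypothesis eta_int : (\int[lebesgue_measure]_x (eta x)%:E = 1)%E.

Lemma derive1n_eta_out i x : x \notin `]0, 1[ -> derive1n i eta x = 0.
Proof.
move=> x01; apply: (derive1n_eq0_notin (@closed_closure _ [set x : R | eta x != 0])).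
  move=> z zS; apply/eqP; apply: contra_notT zS => zS; exact: subset_closure.
by move=> /eta_supp /=; exact/negP.
Qed.

Lemma derive1n_eta_scaled_out c i x : 0 < c -> x \notin `]0, c^-1[ ->
  derive1n i (eta_scaled eta c) x = 0.
Proof.
move=> c0 xc; rewrite derive1n_eta_scaled// derive1n_eta_out ?mulr0//.
apply: contra xc; rewrite !in_itv/= pmulr_rgt0// => /andP[->/=].
by rewrite -[c^-1]mulr1 ltr_pdivlMl.
Qed.

(** Real-valued because the supremum is finite ([sup_normE]), so that [fine] never falls back on its
    default. *)
Definition sup_norm i : R := fine (ereal_sup [set `|derive1n i eta t|%:E | t in setT]).

Lemma sup_normE i :
  ereal_sup [set `|derive1n i eta t|%:E | t in setT] = (sup_norm i)%:E.
Proof.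
have [A A0 HA] := bounded_of_support ler01
  (@continuous_derive1n eta i eta_smooth) (fun x => @derive1n_eta_out i x).
rewrite /sup_norm fineK// fin_numE; apply/andP; split.
  rewrite -ltNye; apply: (@lt_le_trans _ _ `|derive1n i eta 0|%:E); first exact: ltNyr.
  by apply: ereal_sup_ubound; exists 0.
rewrite -ltey; apply: (@le_lt_trans _ _ A%:E); last exact: ltry.
by apply: ge_ereal_sup => _ [t _ <-]; rewrite lee_fin.
Qed.

Lemma le_sup_norm i x : `|derive1n i eta x| <= sup_norm i.
Proof. by rewrite -lee_fin -sup_normE; apply: ereal_sup_ubound; exists x. Qed.

Lemma sup_norm_ge0 i : 0 <= sup_norm i.
Proof. exact: le_trans (le_sup_norm i 0). Qed.

Lemma Ck_norm_eta k : Ck_norm setT k eta = (\sum_(i < k.+1) sup_norm i)%:E.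
Proof. by rewrite /Ck_norm -sumEFin; apply: eq_bigr => i _; exact: sup_normE. Qed.

Lemma integral_eta01 : \int[lebesgue_measure]_(u in `[0, 1]) eta u = 1.
Proof.
rewrite Rintegral_mkcond (_ : eta \_ _ = eta) /Rintegral ?eta_int//.
apply/funext => u; rewrite patchE; case: ifPn => // /negP u01.
apply/esym/(@derive1n_eta_out 0); apply/negP => u01'; apply: u01; rewrite inE.
exact: subset_itv_oo_cc.
Qed.

Lemma continuous_eta : continuous eta.
Proof. exact: (@continuous_derive1n eta 0 eta_smooth). Qed.

(** A function of mass 1 on an interval of length 1 has supremum at least 1. This is the source of
    [1 <= H eps]. *)
Lemma sup_norm0_ge1 : 1 <= sup_norm 0.
Proof.
rewrite -integral_eta01 -[leRHS]mulr1 -[X in _ * X](subr0 1).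
rewrite -Rintegral_itv_cst//; apply: le_Rintegral => //.
- exact/continuous_itv_integrable/continuous_eta.
- by apply: (continuous_itv_integrable (f := fun=> sup_norm 0)); exact: cst_continuous.
- by move=> u _; rewrite -[eta u]ger0_norm//; exact: (le_sup_norm 0).
Qed.

Section derivatives.
Variables (c : R) (Y : R -> R).
Hypotheses (c_ge1 : 1 <= c) (cY : continuous Y) (Yc : forall s, `|Y s| <= c).

Let c_gt0 : 0 < c. Proof. exact: lt_le_trans c_ge1. Qed.

Lemma smooth_conv_eta : smooth (conv (eta_scaled eta c) Y).
Proof.
apply: (@smooth_conv _ _ c^-1) => //; first by rewrite invr_ge0 ltW.
- exact: smooth_eta_scaled.
- by move=> i x; exact: derive1n_eta_scaled_out.
Qed.

(** The kernel contributes [c ^+ i.+1 * sup_norm i], the path [c] and the window [c^-1]; the last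
    two cancel. *)
Lemma norm_derive1n_conv_eta i t :
  `|derive1n i (conv (eta_scaled eta c) Y) t| <= sup_norm i * c ^+ i.+1.
Proof.
rewrite (@derive1n_conv _ _ c^-1)//; last 3 first.
- by rewrite invr_ge0 ltW.
- exact: smooth_eta_scaled.
- by move=> j x; exact: derive1n_eta_scaled_out.
apply: (@le_trans _ _ (c ^+ i.+1 * sup_norm i * c * c^-1)); last first.
  by rewrite mulfK ?gt_eqF// mulrC.
apply: conv_bound => //.
- by rewrite invr_ge0 ltW.
- by apply: continuous_derive1n; exact: smooth_eta_scaled.
- by move=> x; exact: derive1n_eta_scaled_out.
- move=> x; rewrite derive1n_eta_scaled// normrM ger0_norm ?exprn_ge0 ?(ltW c_gt0)//.
  by rewrite ler_pM2l ?exprn_gt0// le_sup_norm.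
Qed.

(** Orders 1 to [k.+1] of the path occur, each with a power of [c] at most [k.+2]. No factor [k]
    appears, so the bound keeps its meaning at [k = 0]. *)
Lemma Ck_norm_derive_conv_eta k T :
  (Ck_norm `[0%R, T] k ((conv (eta_scaled eta c) Y)^`())%classic <=
   (fine (Ck_norm setT k.+2 eta) * c ^+ k.+2)%:E)%E.
Proof.
apply: (@le_trans _ _ (\sum_(i < k.+1) sup_norm i.+1 * c ^+ k.+2)%:E); last first.
  rewrite Ck_norm_eta/= -big_distrl/= lee_fin ler_wpM2r ?exprn_ge0 ?(ltW c_gt0)//.
  (* Dropping the terms of order 0 and [k.+2] from the norm of [eta] leaves exactly the orders 1 to
     [k.+1]. *)
  rewrite [leRHS]big_ord_recl [leRHS]addrC [X in X + _]big_ord_recr/= -addrA lerDl.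
  by rewrite addr_ge0 ?sup_norm_ge0.
rewrite /Ck_norm -sumEFin.
apply: lee_sum => i _; apply: ge_ereal_sup => _ [t _ <-]; rewrite lee_fin.
have -> : derive1n i (conv (eta_scaled eta c) Y)^`()%classic =
    derive1n i.+1 (conv (eta_scaled eta c) Y) by rewrite /derive1n iterSr.
apply: (le_trans (norm_derive1n_conv_eta _ _)).
apply: ler_wpM2l; first exact: sup_norm_ge0.
by apply: ler_weXn2l => //; rewrite ltnS; exact: ltn_ord.
Qed.

End derivatives.

End eta.

Lemma psi_ge1 (beta eps : R) : 0 < beta -> small_eps eps -> 1 <= psi beta eps.
Proof.
move=> b0 [_ l1]; apply: (@le_trans _ _ (1 `^ beta)); first by rewrite powR1.
by apply: ge0_ler_powR; rewrite ?nnegrE// ?(ltW b0)// (le_trans ler01).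
Qed.

End mollifier.

(** * Dyadic chaining *)

Section chaining.
Context {R : realType}.
Implicit Types (x : R -> R) (s t : R).

(** The grid point of level [n] just below [t], meant for [t >= 0]. *)
Definition dyadic_floor (n : nat) t : R := (Num.truncn (t * 2 ^+ n))%:R / 2 ^+ n.

Lemma dyadic_floor_itv n t : 0 <= t -> dyadic_floor n t <= t < dyadic_floor n t + 2 ^- n.
Proof.
move=> t0; have n0 : 0 < 2 ^+ n :> R by rewrite exprn_gt0.
have /truncn_itv/andP[? ?] : 0 <= t * 2 ^+ n by rewrite mulr_ge0 ?exprn_ge0.
rewrite /dyadic_floor ler_pdivrMr//= -[X in _ + X]mul1r -mulrDl ltr_pdivlMr//.
by rewrite natr1; apply/andP.
Qed.

Lemma exists_exp2V_lt (d : R) : 0 < d -> exists n, 2 ^- n < d.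
Proof.
move=> d0; exists (Num.bound d^-1).
rewrite -[ltRHS]invrK ltf_pV2 ?posrE ?exprn_gt0 ?invr_gt0//.
exact: upper_nthrootP.
Qed.

Section modulus.
Variables (x : R -> R) (q C : R) (M : nat).
Hypotheses (q_gt0 : 0 < q) (q_lt1 : q < 1) (C_ge0 : 0 <= C) (cx : continuous x).
Hypothesis step : forall n k, (k < M * 2 ^ n)%N ->
  `|x (k.+1%:R / 2 ^+ n) - x (k%:R / 2 ^+ n)| <= C * q ^+ n.

Let q1_gt0 : 0 < 1 - q. Proof. by rewrite subr_gt0. Qed.

Let truncn_le t n : 0 <= t <= M%:R -> (Num.truncn (t * 2 ^+ n) <= M * 2 ^ n)%N.
Proof.
move=> /andP[t0 tM]; rewrite -ltnS -(ltr_nat R).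
have /truncn_itv/andP[H _] : 0 <= t * 2 ^+ n by rewrite mulr_ge0 ?exprn_ge0.
apply: (le_lt_trans H); rewrite -[ltRHS]natr1 natrM natrX.
by apply: (@le_lt_trans _ _ (M%:R * 2 ^+ n)); rewrite ?ltrDl// ler_wpM2r ?exprn_ge0.
Qed.

(** Refining the grid moves the floor by at most one cell: the new index is twice the old one, or
    that plus 1. *)
Let dyadic_floor_step n t : 0 <= t <= M%:R ->
  `|x (dyadic_floor n.+1 t) - x (dyadic_floor n t)| <= C * q ^+ n.+1.
Proof.
move=> tM; have /andP[t0 _] := tM.
have /truncn_itv/andP[] : 0 <= t * 2 ^+ n by rewrite mulr_ge0 ?exprn_ge0.
have /truncn_itv/andP[] : 0 <= t * 2 ^+ n.+1 by rewrite mulr_ge0 ?exprn_ge0.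
have := truncn_le n.+1 tM.
rewrite /dyadic_floor.
move: (Num.truncn (t * 2 ^+ n.+1)) (Num.truncn (t * 2 ^+ n)) => k m kM k1 k2 m1 m2.
have -> : m%:R / 2 ^+ n = (2 * m)%:R / 2 ^+ n.+1 :> R.
  by rewrite exprS natrM -mulf_div divff ?mul1r.
have mk : (2 * m <= k)%N.
  rewrite -ltnS -(ltr_nat R); apply: le_lt_trans k2.
  by rewrite natrM exprS mulrCA ler_pM2l.
have km : (k <= (2 * m).+1)%N.
  have e2 : (2 * m).+2 = (2 * m.+1)%N by rewrite mulnS.
  rewrite -ltnS e2 -(ltr_nat R).
  apply: (le_lt_trans k1).
  by rewrite natrM exprS mulrCA ltr_pM2l.
have [->|km'] := eqVneq k (2 * m)%N.
  by rewrite subrr normr0 mulr_ge0// exprn_ge0// ltW.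
have ek : k = (2 * m).+1 by apply/eqP; rewrite eqn_leq km ltn_neqAle eq_sym km'.
by rewrite ek step// -ek.
Qed.

Let dyadic_floor_tail n m t : 0 <= t <= M%:R ->
  `|x (dyadic_floor (n + m) t) - x (dyadic_floor n t)| <=
  C * (q ^+ n - q ^+ (n + m)) / (1 - q).
Proof.
move=> tM; elim: m => [|m IH]; first by rewrite addn0 !subrr normr0 mulr0 mul0r.
rewrite addnS; set a := x _; set b := x _; set z := x (dyadic_floor (n + m) t) in IH *.
rewrite -(subrKA z) (le_trans (ler_normD _ _))//.
apply: (le_trans (lerD (dyadic_floor_step _ tM) IH)).
rewrite -subr_ge0.
(* The telescoped form of the geometric sum is not sharp; this is the nonnegative slack gained at
   each induction step. *)
have -> : C * (q ^+ n - q ^+ (n + m).+1) / (1 - q) -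
    (C * q ^+ (n + m).+1 + C * (q ^+ n - q ^+ (n + m)) / (1 - q)) =
    C * (q ^+ (n + m) - q ^+ (n + m).+1).
  by rewrite exprS; field; exact: lt0r_neq0.
by rewrite mulr_ge0// exprS subr_ge0 ler_piMl ?exprn_ge0// ltW.
Qed.

(** The floors converge to [t] and [x] is continuous, so the tail bound, uniform in [m], passes to
    the limit. *)
Let dyadic_floor_approx n t : 0 <= t <= M%:R ->
  `|x t - x (dyadic_floor n t)| <= C * q ^+ n / (1 - q).
Proof.
move=> tM; have /andP[t0 _] := tM.
apply/ler_addgt0Pr => e e0.
have ct : x z @[z --> t] --> x t by exact: cx.
move/cvgrPdist_lt : ct => /(_ _ e0)[d /= d0 H].
have [m md] := exists_exp2V_lt d0.
have {}H : `|x t - x (dyadic_floor (n + m) t)| < e.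
  apply: H; rewrite /ball_/=.
  have /andP[D1 D2] := dyadic_floor_itv (n + m) t0.
  rewrite ger0_norm ?subr_ge0// ltrBlDl; apply: (lt_le_trans D2); rewrite lerD2l.
  apply: ltW; apply: le_lt_trans md.
  by rewrite lef_pV2 ?posrE ?exprn_gt0// ler_weXn2l ?ler1n// leq_addl.
rewrite -(subrKA (x (dyadic_floor (n + m) t))) (le_trans (ler_normD _ _))// addrC.
apply: lerD; last exact: ltW.
apply: (le_trans (dyadic_floor_tail _ _ tM)).
rewrite ler_pM2r ?invr_gt0// ler_wpM2l// lerBlDr lerDl; exact/exprn_ge0/ltW.
Qed.

(** Points at distance at most one cell have equal or neighbouring floors, so a single [step] joins
    them. *)
Let dyadic_floor_adjacent n s t : 0 <= s -> s <= t -> t <= M%:R -> t - s <= 2 ^- n ->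
  `|x (dyadic_floor n t) - x (dyadic_floor n s)| <= C * q ^+ n.
Proof.
move=> s0 st tM ts; have t0 := le_trans s0 st.
have n0 : 0 < 2 ^+ n :> R by rewrite exprn_gt0.
have /truncn_itv/andP[] : 0 <= s * 2 ^+ n by rewrite mulr_ge0 ?exprn_ge0.
have /truncn_itv/andP[] : 0 <= t * 2 ^+ n by rewrite mulr_ge0 ?exprn_ge0.
have := @truncn_le t n; rewrite t0 tM => /(_ isT).
rewrite /dyadic_floor.
move: (Num.truncn (t * 2 ^+ n)) (Num.truncn (s * 2 ^+ n)) => k m kM k1 k2 m1 m2.
have st' : s * 2 ^+ n <= t * 2 ^+ n by rewrite ler_pM2r.
have ts' : t * 2 ^+ n <= s * 2 ^+ n + 1.
  by rewrite -lerBlDl -mulrBl -ler_pdivlMr// mul1r.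
have mk : (m <= k)%N by rewrite -ltnS -(ltr_nat R); lra.
have km : (k <= m.+1)%N.
  by rewrite -ltnS -(ltr_nat R) -[ltRHS]natr1; lra.
have [->|km'] := eqVneq k m.
  by rewrite subrr normr0 mulr_ge0// exprn_ge0// ltW.
have ek : k = m.+1 by apply/eqP; rewrite eqn_leq km ltn_neqAle eq_sym km'.
by rewrite ek step// -ek.
Qed.

Lemma dyadic_modulus n s t : 0 <= s -> s <= t -> t <= M%:R -> t - s <= 2 ^- n ->
  `|x t - x s| <= C * (1 + 2 / (1 - q)) * q ^+ n.
Proof.
move=> s0 st tM ts.
have := dyadic_floor_adjacent s0 st tM ts.
have /(dyadic_floor_approx n) : 0 <= t <= M%:R by rewrite tM (le_trans s0).
have /(dyadic_floor_approx n) : 0 <= s <= M%:R by rewrite s0 (le_trans st).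
move: (dyadic_floor n s) (dyadic_floor n t) => a b ha hb hab.
have -> : C * (1 + 2 / (1 - q)) * q ^+ n =
  C * q ^+ n / (1 - q) + C * q ^+ n + C * q ^+ n / (1 - q) by ring.
have -> : x t - x s = (x t - x b) + (x b - x a) + (x a - x s) by ring.
apply: (le_trans (ler_normD _ _)); apply: lerD; last by rewrite distrC.
by apply: (le_trans (ler_normD _ _)); apply: lerD.
Qed.

End modulus.

(** With [q = 2 ^ -g] the modulus at scale [2 ^- n] is a multiple of [(2 ^- n) ^ g]. Choosing the
    scale within a factor 2 of the gap costs only [2 ^ g <= 2]. *)
Lemma holder_of_dyadic x (g C : R) (M : nat) : 0 < g -> g <= 1 -> 0 <= C ->
  continuous x ->
  (forall n k, (k < M * 2 ^ n)%N ->
    `|x (k.+1%:R / 2 ^+ n) - x (k%:R / 2 ^+ n)| <= C * (2 `^ (- g)) ^+ n) ->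
  exists2 K : R, 0 <= K & forall s t, 0 <= s <= M%:R -> 0 <= t <= M%:R ->
    `|x t - x s| <= K * `|t - s| `^ g.
Proof.
move=> g0 g1 C0 cx step; set q := 2 `^ (- g) in step.
have q0 : 0 < q by rewrite powR_gt0.
have q1 : q < 1.
  rewrite /q powRN invf_lt1 ?powR_gt0//.
  apply: (@le_lt_trans _ _ (1 `^ g)); first by rewrite powR1.
  by apply: gt0_ltr_powR; rewrite ?nnegrE// ltr1n.
have : {within `[0, M%:R], continuous (fun t => `|x t|)}.
  apply: continuous_subspaceT => t.
  exact: (continuous_comp (cx t) (@norm_continuous _ R^o _)).
have M0 : 0 <= M%:R :> R by [].
move=> /(EVT_max M0)[c _ xB].
set B := `|x c| in xB; have B0 : 0 <= B by rewrite /B.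
set C' := C * (1 + 2 / (1 - q)).
have C'0 : 0 <= C' by rewrite mulr_ge0// addr_ge0// divr_ge0// subr_ge0 ltW.
have K0 : 0 <= 2 * C' + 2 * B by apply: addr_ge0; exact: mulr_ge0.
(* [2 * C'] serves gaps up to 1, by chaining; [2 * B] serves longer gaps, by the maximum of
   [|x|]. *)
exists (2 * C' + 2 * B) => //.
suff wl s t : 0 <= s <= M%:R -> 0 <= t <= M%:R -> s <= t ->
    `|x t - x s| <= (2 * C' + 2 * B) * `|t - s| `^ g.
  move=> s t sM tM; have [st|/ltW ts] := leP s t; first exact: wl.
  by rewrite distrC [`|t - s|]distrC; exact: wl.
move=> /andP[s0 sM] /andP[t0 tM].
rewrite le_eqVlt => /predU1P[->|st].
  by rewrite !subrr normr0 mulr_ge0 ?powR_ge0.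
have ts0 : 0 < t - s by rewrite subr_gt0.
rewrite [X in X `^ _]gtr0_norm//.
have [ts1|ts1] := leP (t - s) 1; last first.
  apply: (@le_trans _ _ (2 * B)).
    rewrite mulrDl mul1r (le_trans (ler_normB _ _))//.
    by apply: lerD; apply: xB; rewrite in_itv/= ?s0 ?t0.
  apply: (@le_trans _ _ (2 * C' + 2 * B)); first by rewrite lerDr mulr_ge0.
  apply: ler_peMr => //.
  apply: (@le_trans _ _ (1 `^ g)); first by rewrite powR1.
  by apply: ge0_ler_powR; rewrite ?nnegrE// ?ltW// (lt_trans ltr01).
(* The least such [n] also satisfies [t - s <= 2 ^- n], by minimality, or by [ts1] when [n = 0]. *)
have exn : exists n, 2 ^- n.+1 < t - s.
  have [n nts] := exists_exp2V_lt ts0; exists n; apply: le_lt_trans nts.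
  by rewrite lef_pV2 ?posrE ?exprn_gt0// ler_weXn2l ?ler1n.
case: (ex_minnP exn) => n nts nmin.
have tsn : t - s <= 2 ^- n.
  case: n nts nmin => [|n] nts nmin; first by rewrite expr0 invr1.
  by rewrite leNgt; apply/negP => /nmin; rewrite ltnn.
apply: (le_trans (dyadic_modulus q0 q1 C0 cx step s0 (ltW st) tM tsn)).
rewrite -/C'; apply: (@le_trans _ _ (2 * C' * (t - s) `^ g)); last first.
  by rewrite ler_wpM2r ?powR_ge0// lerDl mulr_ge0.
rewrite -[leRHS]mulrA mulrCA. rewrite ler_wpM2l//.
have -> : q ^+ n = (2 ^- n) `^ g.
  by rewrite /q -powR_mulrn ?powR_ge0// -powRrM mulNr mulrC -mulNr powRrM powRN powR_mulrn.
apply: (@le_trans _ _ ((2 * (t - s)) `^ g)).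
  apply: ge0_ler_powR; rewrite ?nnegrE ?invr_ge0 ?exprn_ge0 ?mulr_ge0 ?(ltW g0) ?(ltW ts0)//.
  rewrite -ler_pdivrMl// -invfM -exprS; exact: ltW.
rewrite powRM ?(ltW ts0)// ler_wpM2r ?powR_ge0//.
apply: (@le_trans _ _ (2 `^ 1)); last by rewrite powRr1.
by apply: ler_powR => //; rewrite ler1n.
Qed.

End chaining.

(** * Gaussian tails and Brownian increments *)

Section normal_tail.
Context {R : realType}.
Implicit Types s l x y : R.

(** Square [y / 2 <= expR (y / 2)]. Polynomial decay is enough for the union bound over dyadic
    cells. *)
Lemma expRN_le_sqr y : 0 < y -> expR (- y) <= 4 / y ^+ 2.
Proof.
move=> y0; have e2 : y / 2 <= expR (y / 2).
  by apply: le_trans (expR_ge1Dx _); rewrite lerDr.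
rewrite expRN -[4]invrK -invfM lef_pV2 ?posrE ?expR_gt0 ?mulr_gt0 ?invr_gt0 ?exprn_gt0//.
have -> : 4^-1 * y ^+ 2 = (y / 2) ^+ 2 by field.
have -> : expR y = expR (y / 2) ^+ 2 by rewrite -expRM_natl; congr expR; field.
by rewrite ler_pXn2r ?nnegrE ?expR_ge0// divr_ge0// ltW.
Qed.

(* Half of the exponent is traded for a normal density of twice the variance,
   which has total mass 1; the other half yields the decay in l. *)
Lemma normal_pdf_tail s l x : 0 < s -> 0 < l -> l < `|x| ->
  normal_pdf 0 s x <= 128 * (s / l) ^+ 4 * normal_pdf 0 (Num.sqrt 2 * s) x.
Proof.
move=> s0 l0 lx; set s' := Num.sqrt 2 * s.
have s'0 : 0 < s' by rewrite mulr_gt0// sqrtr_gt0.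
have s'2 : s' ^+ 2 = 2 * s ^+ 2 by rewrite exprMn sqr_sqrtr.
rewrite !normal_pdfE ?gt_eqF// /normal_fun subr0.
have peakE : normal_peak s = Num.sqrt 2 * normal_peak s'.
  rewrite /normal_peak; have -> : s' ^+ 2 * pi *+ 2 = 2 * (s ^+ 2 * pi *+ 2).
    by rewrite s'2; ring.
  by rewrite sqrtrM// invfM mulrA divff ?mul1r// gt_eqF// sqrtr_gt0.
have funE : - x ^+ 2 / (s ^+ 2 *+ 2) =
    - (x ^+ 2 / (4 * s ^+ 2)) + - x ^+ 2 / (s' ^+ 2 *+ 2).
  by rewrite s'2; field; exact: lt0r_neq0.
rewrite peakE funE expRD.
set p := normal_peak s'; set f := expR (_ / _).
have p0 : 0 <= p by exact: normal_peak_ge0.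
have f0 : 0 <= f by exact: expR_ge0.
rewrite [leLHS](_ : _ = Num.sqrt 2 * expR (- (x ^+ 2 / (4 * s ^+ 2))) * (p * f)); last by ring.
apply: ler_wpM2r; first exact: mulr_ge0.
(* The factor [Num.sqrt 2] is rounded up to 2, and [4 / y ^+ 2] at [y = l ^+ 2 / (4 * s ^+ 2)] is
   [64 * (s / l) ^+ 4]. *)
have -> : 128 * (s / l) ^+ 4 = 2 * (64 * (s / l) ^+ 4) by ring.
apply: ler_pM; rewrite ?sqrtr_ge0 ?expR_ge0//.
  by rewrite -(@ler_pXn2r _ 2) ?nnegrE ?sqrtr_ge0// sqr_sqrtr// expr2 ler_peMl// ler1n.
have y0 : 0 < l ^+ 2 / (4 * s ^+ 2) by rewrite divr_gt0// ?mulr_gt0// exprn_gt0.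
apply: le_trans (_ : expR (- (l ^+ 2 / (4 * s ^+ 2))) <= _).
  rewrite ler_expR lerN2 ler_pM2r ?invr_gt0 ?mulr_gt0 ?exprn_gt0//.
  by rewrite -[x ^+ 2]real_normK ?num_real// ler_pXn2r ?nnegrE// ltW.
apply: (le_trans (expRN_le_sqr y0)).
rewrite le_eqVlt; apply/orP; left; apply/eqP.
by field; rewrite !gt_eqF.
Qed.

Lemma measurable_normr_gt l : measurable [set y : R | l < `|y|].
Proof.
have : measurable_fun [set: R] (fun y : R => `|y|) by exact: measurableT_comp.
move=> /(_ measurableT _ (measurable_itv `]l, +oo[)); rewrite setTI.
by congr (measurable _); apply/seteqP; split => y /=; rewrite in_itv/= andbT.
Qed.

(** Integrate the pointwise comparison, then enlarge the domain to the whole line, where the wider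
    density has mass 1. *)
Lemma normal_prob_tail s l : 0 < s -> 0 < l ->
  (normal_prob 0 s [set y : R | (l < `|y|)%R] <= (128 * (s / l) ^+ 4)%:E)%E.
Proof.
move=> s0 l0; rewrite /normal_prob.
set s' := Num.sqrt 2 * s; set K := 128 * _.
have K0 : 0 <= K by rewrite mulr_ge0// exprn_ge0// divr_ge0 ?ltW.
have mA := measurable_normr_gt l.
have mpdf m z : measurable_fun [set: R] (EFin \o normal_pdf m z).
  by apply/measurable_EFinP; exact: measurable_normal_pdf.
have mKpdf : measurable_fun [set: R] (cst K%:E \* (EFin \o normal_pdf 0 s'))%E.
  by apply: emeasurable_funM => //; exact: mpdf.
apply: (@le_trans _ _ (\int[lebesgue_measure]_(x in [set y : R | (l < `|y|)%R])
    (K%:E * (normal_pdf 0 s' x)%:E))%E).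
  apply: ge0_le_integral => //.
  - by move=> x _; rewrite lee_fin normal_pdf_ge0.
  - by apply: measurable_funTS; exact: mpdf.
  - by apply: measurable_funTS; exact: mKpdf.
  - by move=> x lx; rewrite -EFinM lee_fin; exact: normal_pdf_tail.
apply: (@le_trans _ _ (\int[lebesgue_measure]_x (K%:E * (normal_pdf 0 s' x)%:E))%E).
  apply: ge0_subset_integral => // x _.
  by rewrite -EFinM lee_fin mulr_ge0// normal_pdf_ge0.
rewrite ge0_integralZl//; [|exact: mpdf|by move=> x _; rewrite lee_fin normal_pdf_ge0].
by rewrite integral_normal_pdf mule1.
Qed.

End normal_tail.

(** * Borel-Cantelli for dyadic Brownian increments *)

Section brownian.
Context {R : realType} {d : measure_display} {Omega : measurableType d}.
Context {P : probability Omega R} {w : R -> {RV P >-> R}}.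
Hypothesis hw : brownian_motion w.

Lemma measurable_increment_gt s t l : measurable [set omega | l < `|w t omega - w s omega|].
Proof.
have mf : measurable_fun [set: Omega] (fun omega => w t omega - w s omega).
  by apply: measurable_funB.
have := mf measurableT _ (measurable_normr_gt l).
by rewrite setTI.
Qed.

(** With standard deviation [Num.sqrt (t - s)], the fourth power becomes [(t - s) ^+ 2], small
    enough to beat the number of dyadic cells. *)
Lemma brownian_increment_tail s t l : 0 <= s -> s < t -> 0 < l ->
  (P [set omega | (l < `|w t omega - w s omega|)%R] <=
   (128 * (t - s) ^+ 2 / l ^+ 4)%:E)%E.
Proof.
move=> s0 st l0; have [_ _ hN _] := hw.
rewrite (hN _ _ s0 st _ (measurable_normr_gt l)).
have ts0 : 0 < t - s by rewrite subr_gt0.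
apply: (le_trans (normal_prob_tail _ l0)); first by rewrite sqrtr_gt0.
by rewrite lee_fin expr_div_n (exprM _ 2 2) sqr_sqrtr ?(ltW ts0)// mulrA.
Qed.

Section dyadic.
Variables (q : R) (M : nat).
Hypotheses (q_gt0 : 0 < q) (q4 : 1 < 2 * q ^+ 4).

(** The event that the chaining hypothesis with [C = 1] fails at level [n]. *)
Definition big_increment (n : nat) : set Omega :=
  \bigcup_(k < (M * 2 ^ n)%N)
    [set omega | q ^+ n < `|w (k.+1%:R / 2 ^+ n) omega - w (k%:R / 2 ^+ n) omega|].

Lemma measurable_big_increment n : measurable (big_increment n).
Proof. by apply: bigcup_measurable => k _; exact: measurable_increment_gt. Qed.

(** Union bound: [M * 2 ^ n] cells, each of probability at most [128 * 2 ^ (-2n) / q ^ (4n)]. *)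
Lemma prob_big_increment n :
  (P (big_increment n) <= (128 * M%:R * (2 * q ^+ 4)^-1 ^+ n)%:E)%E.
Proof.
pose A (k : nat) := [set omega |
  q ^+ n < `|w (k.+1%:R / 2 ^+ n) omega - w (k%:R / 2 ^+ n) omega|].
have mA k : (k < M * 2 ^ n)%N -> measurable (A k).
  by move=> _; exact: measurable_increment_gt.
rewrite /big_increment bigcup_mkord; apply: (le_trans (Boole_inequality P mA)).
have n0 : 0 < 2 ^+ n :> R by rewrite exprn_gt0.
apply: (@le_trans _ _ (\sum_(k < M * 2 ^ n) (128 * (2 ^- n) ^+ 2 / (q ^+ n) ^+ 4)%:E)%E).
  apply: lee_sum => k _.
  apply: (le_trans (brownian_increment_tail _ _ _)).
  - by rewrite divr_ge0// ltW.
  - by rewrite ltr_pM2r ?invr_gt0// ltr_nat.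
  - exact: exprn_gt0.
  - have k1 : k.+1%:R - k%:R = 1 :> R by rewrite -natr1; ring.
    by rewrite -mulrBl k1 mul1r.
rewrite sumEFin lee_fin sumr_const card_ord -[leLHS]mulr_natl natrM natrX.
rewrite le_eqVlt; apply/orP; left; apply/eqP.
have -> : (2 * q ^+ 4)^-1 ^+ n = (2 ^+ n * (q ^+ n) ^+ 4)^-1.
  by rewrite exprVn exprMn -[in RHS]exprM mulnC exprM.
by field; rewrite !gt_eqF ?exprn_gt0.
Qed.

(** The assumption [1 < 2 * q ^+ 4] makes the bounds a convergent geometric series, so
    Borel-Cantelli applies. *)
Lemma lim_sup_big_increment : P (lim_sup_set big_increment) = 0%E.
Proof.
apply: lim_sup_set_cvg0 => [n|]; first exact: measurable_big_increment.
set r := (2 * q ^+ 4)^-1; have r0 : 0 < r by rewrite invr_gt0 (lt_trans ltr01).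
have r1 : r < 1 by rewrite invf_lt1// (lt_trans ltr01).
apply: (@le_lt_trans _ _ (\sum_(0 <= n <oo) (geometric (128 * M%:R) r n)%:E)%E).
  apply: lee_nneseries => n _ //=; exact: prob_big_increment.
apply: (@le_lt_trans _ _ (128 * M%:R / (1 - r))%:E); last exact: ltry.
apply: lime_le.
  by apply: is_cvg_nneseries => n _ _; rewrite lee_fin mulr_ge0 ?exprn_ge0 ?mulr_ge0// ltW.
apply: nearW => n; rewrite sumEFin lee_fin.
by apply: geometric_le_lim; rewrite ?mulr_ge0// ger0_norm// ltW.
Qed.

End dyadic.

End brownian.

(** * Hoelder convergence *)

Section brownian_holder.
Context {R : realType} {d : measure_display} {Omega : measurableType d}.
Context {P : probability Omega R} {w : R -> {RV P >-> R}}.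
Hypothesis hw : brownian_motion w.

(** For [q = 2 ^ -g] summability requires [g < 1 / 4]; the choice [g = 1 / 8] gives
    [2 * q ^+ 4 = 2 ^ (1 / 2)]. *)
Lemma brownian_holder (M : nat) : {ae P, forall omega : Omega,
  exists2 K : R, 0 <= K & forall s t, 0 <= s <= M%:R -> 0 <= t <= M%:R ->
    `|w t omega - w s omega| <= K * `|t - s| `^ 8^-1}.
Proof.
set q : R := 2 `^ (- 8^-1).
have q0 : 0 < q by rewrite powR_gt0.
have q4 : 1 < 2 * q ^+ 4.
  have -> : 2 * q ^+ 4 = 2 `^ 2^-1.
    rewrite /q -powR_mulrn ?powR_ge0// -powRrM -[X in X * _]powRr1// -powRD.
      by congr (_ `^ _); field.
    by rewrite pnatr_eq0 implybT.
  apply: (@le_lt_trans _ _ (1 `^ 2^-1)); first by rewrite powR1.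
  by apply: gt0_ltr_powR; rewrite ?invr_gt0 ?nnegrE// ltr1n.
exists (lim_sup_set (@big_increment _ _ _ _ w q M)); split.
- apply: bigcap_measurable => // n _.
  by apply: bigcup_measurable => j _; exact: measurable_big_increment.
- exact: lim_sup_big_increment.
(* By contraposition: outside the limsup set, large increments occur at finitely many levels
   only. *)
move=> omega /=; apply: contra_notP => nlim.
have [n0 small] : exists n0, forall n, (n0 <= n)%N -> ~ @big_increment _ _ _ _ w q M n omega.
  have /existsNP[n0 H] : ~ forall n, exists2 m, (n <= m)%N & @big_increment _ _ _ _ w q M m omega.
    by move=> H; apply: nlim => n _; have [m nm ?] := H n; exists m.
  by exists n0 => n nn0 Hn; apply: H; exists n.
have [h0 hc _ _] := hw.
pose x s := w (Num.max s 0) omega.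
have cx : continuous x by exact: (continuous_maxr0 (hc omega)).
have xE s : 0 <= s -> x s = w s omega by move=> s0; rewrite /x max_l.
have M0 : 0 <= M%:R :> R by [].
have : {within `[0, M%:R], continuous (fun t => `|x t|)}.
  apply: continuous_subspaceT => t.
  exact: (continuous_comp (cx t) (@norm_continuous _ R^o _)).
move=> /(EVT_max M0)[c _ xB].
set B : R := `|x c| in xB; have B0 : 0 <= B by rewrite /B.
(* The term 1 covers levels from [n0] on. Below [n0] increments are at most [2 * B], and
   [q ^+ n0 <= q ^+ n]. *)
set C : R := 1 + 2 * B / q ^+ n0.
have C0 : 0 <= C by rewrite addr_ge0// divr_ge0 ?mulr_ge0 ?exprn_ge0// ltW.
have q1 : q <= 1.
  apply: (@le_trans _ _ (2 `^ 0)); last by rewrite powRr0.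
  by apply: ler_powR; rewrite ?ler1n// oppr_le0 invr_ge0.
have e0 : (0 : R) < 8^-1 by rewrite invr_gt0.
have e1 : (8^-1 : R) <= 1 by rewrite invf_le1// ler1n.
have step n k : (k < M * 2 ^ n)%N ->
    `|x (k.+1%:R / 2 ^+ n) - x (k%:R / 2 ^+ n)| <= C * q ^+ n.
  move=> kM; have n1 : 0 < 2 ^+ n :> R by rewrite exprn_gt0.
  have [nn0|nn0] := leqP n0 n.
    apply: (@le_trans _ _ (q ^+ n)); last first.
      by rewrite ler_peMl ?exprn_ge0 ?(ltW q0)// lerDl divr_ge0 ?mulr_ge0 ?exprn_ge0 ?(ltW q0).
    rewrite !xE ?divr_ge0 ?(ltW n1)// leNgt; apply/negP => Hk; apply: (small n nn0).
    by exists k.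
  apply: (@le_trans _ _ (2 * B)).
    rewrite mulrDl mul1r (le_trans (ler_normB _ _))//.
    by apply: lerD; apply: xB; rewrite in_itv/= divr_ge0 ?(ltW n1)//= ler_pdivrMr//
      -natrX -natrM ler_nat// ltnW.
  rewrite /C [leRHS]mulrDl mul1r; apply: ler_wpDl; first by rewrite exprn_ge0 ?(ltW q0).
  rewrite -[leRHS]mulrA; apply: ler_peMr; first by rewrite mulr_ge0.
  rewrite mulrC ler_pdivlMr ?exprn_gt0// mul1r.
  by apply: ler_wiXn2l; rewrite ?q1 ?(ltW q0)// ltnW.
have [K K0 HK] := holder_of_dyadic e0 e1 C0 cx step.
exists K => // s t sM tM; rewrite -!xE; first exact: HK.
  by case/andP: sM.
by case/andP: tM.
Qed.

End brownian_holder.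

(** * Mollification as an average against [eta], and its Hoelder error *)

Section change_of_variables.
Context {R : realType}.
Implicit Types (eta Y h : R -> R) (c s t u x : R).

Local Notation mu := (@lebesgue_measure R).

(** The decreasing substitution [u = c * (t - s)] sends [t - c^-1] to 1 and [t] to 0; the reversed
    orientation absorbs the sign of its derivative [- c]. *)
Lemma Rintegral_affine h c t : 0 < c -> continuous h ->
  \int[mu]_(u in `[0, 1]) h u = \int[mu]_(s in `[t - c^-1, t]) (h (c * (t - s)) * c).
Proof.
move=> c0 ch; pose F s := c * (t - s).
have dF (s : R) : is_derive s 1 F (- c).
  have := is_deriveM (is_derive_cst c s (1:R))
    (is_deriveB (is_derive_cst t s (1:R)) (is_derive_id s (1:R))).
  by rewrite scaler0 addr0 sub0r scalerN /= -[c *: 1]/(c * 1) mulr1.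
have F'E : (F^`())%classic = cst (- c).
  by apply/funext => s; rewrite derive1E; have [_] := dF s.
have cF : continuous F by apply: derivable1_continuous => s; have [] := dF s.
have F1 : F (t - c^-1) = 1 by rewrite /F subKr mulfV// gt_eqF.
have F0 : F t = 0 by rewrite /F subrr mulr0.
have ab : t - c^-1 <= t by rewrite lerBlDr lerDl invr_ge0 ltW.
rewrite /Rintegral -[in LHS]F0 -[in LHS]F1 integration_by_substitution_decreasing//.
- by congr fine; apply: eq_integral => s _; rewrite F'E /= opprK.
- by move=> y z _ _ yz; rewrite /F ltr_pM2l// ltrD2l ltrN2.
- by rewrite F'E => ? _; exact: cvg_cst.
- by rewrite F'E; apply: is_cvg_cst.
- by rewrite F'E; apply: is_cvg_cst.
- split; first by move=> s _; have [] := dF s.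
  + exact/cvg_at_right_filter/cF.
  + exact/cvg_at_left_filter/cF.
- exact: continuous_subspaceT.
Qed.

Section eta.
Variable eta : R -> R.
Hypothesis eta_ge0 : forall x : R, 0 <= eta x.
Hypothesis eta_smooth : smooth eta.
Hypothesis eta_supp : closure [set x : R | eta x != 0] `<=` `]0, 1[.
Hypothesis eta_int : (\int[lebesgue_measure]_x (eta x)%:E = 1)%E.

Let ceta : continuous eta. Proof. exact: continuous_eta. Qed.

Lemma continuous_affine Y c t : continuous Y -> continuous (fun u : R => Y (t - u / c)).
Proof.
move=> cY u; apply: (@continuous_comp _ _ _ (fun u : R => t - u / c) Y); last exact: cY.
by apply: (@cvgB _ R^o); [exact: cvg_cst|apply: cvgM; [exact: cvg_id|exact: cvg_cst]].
Qed.

Lemma conv_eta_scaled Y c t : 0 < c -> continuous Y ->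
  conv (eta_scaled eta c) Y t = \int[mu]_(u in `[0, 1]) (eta u * Y (t - u / c)).
Proof.
move=> c0 cY; rewrite (@conv_itv _ _ _ c^-1); last first.
  by move=> x; exact: (@derive1n_eta_scaled_out _ eta eta_smooth eta_supp c 0).
rewrite (@Rintegral_affine (fun u => eta u * Y (t - u / c)) c t)//; last first.
  by move=> u; apply: cvgM; [exact: ceta|exact: continuous_affine].
apply: eq_Rintegral => s _; rewrite /eta_scaled.
have -> : t - c * (t - s) / c = s by field; rewrite gt_eqF.
by ring.
Qed.

(** As [eta] is a probability density on [[0, 1]], averaging against it preserves bounds. *)
Lemma norm_integral_eta_le h B : continuous h ->
  (forall u, 0 <= u <= 1 -> `|h u| <= B) ->
  `|\int[mu]_(u in `[0, 1]) (eta u * h u)| <= B.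
Proof.
move=> ch hB.
have cf : continuous (fun u => eta u * h u).
  by move=> u; apply: cvgM; [exact: ceta|exact: ch].
apply: (le_trans (le_normr_Rintegral _ _)) => //.
  exact: continuous_itv_integrable.
have -> : B = \int[mu]_(u in `[0, 1]) (B * eta u).
  rewrite RintegralZl//; last exact: continuous_itv_integrable.
  by rewrite integral_eta01// mulr1.
apply: le_Rintegral => //.
- apply: (continuous_itv_integrable (f := fun s => `|eta s * h s|)) => s.
  exact: (continuous_comp (cf s) (@norm_continuous _ R^o _)).
- apply: (continuous_itv_integrable (f := fun u => B * eta u)) => u.
  by apply: cvgM; [exact: cvg_cst|exact: ceta].
- move=> u /=; rewrite in_itv/= => u01.
  by rewrite normrM (ger0_norm (eta_ge0 u)) mulrC ler_wpM2r// hB.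
Qed.

Lemma integral_etaB h1 h2 : continuous h1 -> continuous h2 ->
  \int[mu]_(u in `[0, 1]) (eta u * (h1 u - h2 u)) =
  \int[mu]_(u in `[0, 1]) (eta u * h1 u) - \int[mu]_(u in `[0, 1]) (eta u * h2 u).
Proof.
have ceh h : continuous h -> continuous (fun u => eta u * h u).
  by move=> ch u; apply: cvgM; [exact: ceta|exact: ch].
move=> c1 c2; rewrite -RintegralB//; last 2 first.
- exact/continuous_itv_integrable/ceh.
- exact/continuous_itv_integrable/ceh.
by apply: eq_Rintegral => u _; rewrite mulrBr.
Qed.

Lemma integral_eta_cst (B : R) : \int[mu]_(u in `[0, 1]) (eta u * B) = B.
Proof.
rewrite RintegralZr//; last exact: continuous_itv_integrable.
by rewrite integral_eta01// mul1r.
Qed.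

Section holder.
Variables (x : R -> R) (c T K g theta beta eps : R).
Hypotheses (x0 : x 0 = 0) (cx : {within `[0, +oo[, continuous x}).
Hypotheses (T_gt0 : 0 < T) (K_ge0 : 0 <= K) (theta_gt0 : 0 < theta).
Hypotheses (theta_lt : theta < g).
Hypothesis holder_x : forall s t, 0 <= s <= T -> 0 <= t <= T ->
  `|x t - x s| <= K * `|t - s| `^ g.
Hypothesis cE : c = psi beta eps.
Hypothesis c_ge1 : 1 <= c.
Hypothesis x_lt : forall s, 0 <= s <= T -> `|x s| < c.

Let c_gt0 : 0 < c. Proof. exact: lt_le_trans c_ge1. Qed.
Let g_gt0 : 0 < g. Proof. exact: lt_trans theta_lt. Qed.
Let x' s := x (Num.max s 0).
Let cx' : continuous x'. Proof. exact: continuous_maxr0. Qed.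

Let x'E s : 0 <= s -> x' s = x s. Proof. by move=> s0; rewrite /x' max_l. Qed.

(** Truncation at 0 is 1-Lipschitz, so the Hoelder bound extends to the negative times that
    [t - u / c] may reach. *)
Let holder_x' s t : s <= T -> t <= T -> `|x' t - x' s| <= K * `|t - s| `^ g.
Proof.
have mT s' : s' <= T -> 0 <= Num.max s' 0 <= T.
  by move=> sT; rewrite le_max lexx orbT ge_max sT ltW.
move=> sT tT; apply: (le_trans (holder_x (mT _ sT) (mT _ tT))).
apply: ler_wpM2l => //; apply: ge0_ler_powR; rewrite ?nnegrE// ?(ltW g_gt0)//.
have [t0|t0] := leP t 0; have [s0|s0] := leP s 0.
- by rewrite subrr normr0.
- by rewrite sub0r normrN distrC !gtr0_norm ?subr_gt0 ?(le_lt_trans t0)// lerDl oppr_ge0.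
- by rewrite subr0 !gtr0_norm ?subr_gt0 ?(le_lt_trans s0)// lerDl oppr_ge0.
- by [].
Qed.

(** The kernel looks only into the past, and by [x_lt] the path has not exited before [T], so the
    stopping is invisible. *)
Let w_epsE t : t <= T ->
  w_eps beta eta x eps t = \int[mu]_(u in `[0, 1]) (eta u * x' (t - u / c)).
Proof.
move=> tT; rewrite w_eps_conv// -cE.
have [cY _ _] := stopped_maxr0 c_gt0 x0 cx.
rewrite conv_eta_scaled//; apply: eq_Rintegral => u; rewrite inE/= in_itv/= => /andP[u0 _].
congr (_ * _); apply: stopped_id.
have TE : (T%:E <= exit_time c x)%E.
  by apply: le_exit_time => s s0 sT; apply: x_lt; rewrite ltW.
apply: le_trans TE; rewrite lee_fin ge_max (ltW T_gt0) andbT.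
by apply: le_trans tT; rewrite lerBlDr lerDl divr_ge0// ltW.
Qed.

Let increment t u := x' (t - u / c) - x' t.

Let c_increment t : continuous (increment t).
Proof.
move=> u; apply: (@cvgB _ R^o); last exact: cvg_cst.
exact: (@continuous_affine x' c t cx').
Qed.

(** Mass 1 of [eta] lets [x t] be moved under the integral. *)
Let diffE t : 0 <= t <= T ->
  w_eps beta eta x eps t - x t = \int[mu]_(u in `[0, 1]) (eta u * increment t u).
Proof.
move=> /andP[t0 tT]; rewrite w_epsE// /increment.
rewrite (@integral_etaB (fun u => x' (t - u / c)) (fun=> x' t)).
- by rewrite integral_eta_cst x'E.
- exact: continuous_affine.
- exact: cst_continuous.
Qed.

Let increment_le t u : t <= T -> 0 <= u <= 1 -> `|increment t u| <= K * c^-1 `^ g.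
Proof.
move=> tT /andP[u0 u1].
have uc0 : 0 <= u / c by rewrite divr_ge0// ltW.
apply: (le_trans (holder_x' tT _)); first by rewrite (le_trans _ tT)// lerBlDr lerDl.
apply: ler_wpM2l => //; apply: ge0_ler_powR; rewrite ?nnegrE ?invr_ge0 ?(ltW g_gt0) ?(ltW c_gt0)//.
rewrite addrAC subrr sub0r normrN ger0_norm//.
by rewrite -[leRHS]mul1r ler_wpM2r// invr_ge0 ltW.
Qed.

(** Interpolation, split at [|t - s| = c^-1]: for close times the differences are paired at equal
    lag, for distant ones each increment is bounded by its lag. Either way [g] splits as
    [(g - theta) + theta]. *)
Let increment_diff_le s t u : s <= T -> t <= T -> 0 <= u <= 1 ->
  `|increment t u - increment s u| <= 2 * K * c^-1 `^ (g - theta) * `|t - s| `^ theta.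
Proof.
move=> sT tT u01; have /andP[u0 u1] := u01.
have uc0 : 0 <= u / c by rewrite divr_ge0// ltW.
have gE (a : R) : 0 <= a -> a `^ g = a `^ (g - theta) * a `^ theta.
  move=> a0; rewrite -powRD ?subrK//; apply/implyP => /eqP g0.
  by move: g_gt0; rewrite g0 ltxx.
have gt0 : 0 <= g - theta by rewrite subr_ge0 ltW.
have ic0 : 0 <= c^-1 by rewrite invr_ge0 ltW.
rewrite -!mulrA; have [tsc|tsc] := leP `|t - s| c^-1.
  apply: (@le_trans _ _ (2 * (K * `|t - s| `^ g))).
    have -> : increment t u - increment s u =
        (x' (t - u / c) - x' (s - u / c)) - (x' t - x' s) by rewrite /increment; ring.
    rewrite mulrDl mul1r (le_trans (ler_normB _ _))//; apply: lerD; last exact: holder_x'.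
    have -> : t - s = t - u / c - (s - u / c) by ring.
    by apply: holder_x'; rewrite lerBlDr ler_wpDr.
  rewrite gE// ler_wpM2l// ler_wpM2l// ler_wpM2r ?powR_ge0//.
  by apply: ge0_ler_powR; rewrite ?nnegrE.
apply: (@le_trans _ _ (2 * (K * c^-1 `^ g))).
  rewrite mulrDl mul1r (le_trans (ler_normB _ _))//.
  by apply: lerD; exact: increment_le.
rewrite gE// ler_wpM2l// ler_wpM2l// ler_wpM2l ?powR_ge0//.
by apply: ge0_ler_powR; rewrite ?nnegrE// ltW.
Qed.

(** The constant 3 is 1 from the supremum plus 2 from the seminorm; [c^-1 <= 1] weakens the exponent
    [g] to [g - theta] in the former. *)
Lemma holder_norm_w_eps_le :
  (holder_norm theta T (w_eps beta eta x eps \- x)%R <= (3 * K * c^-1 `^ (g - theta))%:E)%E.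
Proof.
have -> : 3 * K * c^-1 `^ (g - theta) =
  K * c^-1 `^ (g - theta) + 2 * K * c^-1 `^ (g - theta) by ring.
rewrite EFinD; apply: leeD; apply: ge_ereal_sup.
- move=> _ [t /= tT <-]; rewrite in_itv/= in tT; rewrite lee_fin diffE//.
  apply: (@le_trans _ _ (K * c^-1 `^ g)).
    apply: norm_integral_eta_le => // u; apply: increment_le.
    by case/andP: tT.
  rewrite ler_wpM2l// ger_powR ?invr_gt0 ?c_gt0 ?invf_le1//.
  by rewrite lerBlDr lerDl ltW.
- move=> _ [[t s] /= [tT sT ts] <-]; rewrite !in_itv/= in tT sT; rewrite lee_fin.
  rewrite ler_pdivrMr; last by rewrite powR_gt0// normr_gt0 subr_eq0.
  rewrite !diffE// -integral_etaB//; apply: norm_integral_eta_le.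
    by move=> u; apply: (@cvgB _ R^o); exact: c_increment.
  by move=> u; apply: increment_diff_le; [case/andP: sT|case/andP: tT].
Qed.

End holder.

End eta.

(** A supremum over the empty set is [-oo]; for [T > 0] the point 0 and the pair [(0, T)] exclude
    this. *)
Lemma holder_norm_ge0 (theta T : R) (f : R -> R) : 0 < T -> (0 <= holder_norm theta T f)%E.
Proof.
move=> T0; apply: adde_ge0.
- apply: (@le_trans _ _ `|f 0|%:E); first by rewrite lee_fin.
  by apply: ereal_sup_ubound; exists 0 => //=; rewrite in_itv/= lexx ltW.
- apply: (@le_trans _ _ (`|f 0 - f T| / `|0 - T| `^ theta)%:E).
    by rewrite lee_fin divr_ge0// powR_ge0.
  apply: ereal_sup_ubound; exists (0, T) => //=; split.
  + by rewrite in_itv/= lexx ltW.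
  + by rewrite in_itv/= lexx ltW.
  + by rewrite lt_eqF.
Qed.

End change_of_variables.

(** * Limits in eps *)

Section limits.
Context {R : realType}.
Implicit Types A beta eps : R.

Lemma lt_ln_of_expR_lt A (z : R) : expR A < z -> A < ln z.
Proof.
by move=> h; rewrite -[A]expRK ltr_ln// posrE ?expR_gt0// (lt_trans (expR_gt0 A)).
Qed.

Lemma log3_cvg : @log3 R eps @[eps --> 0^'+] --> +oo.
Proof.
apply/cvgryPge => A; near=> eps.
have e0 : 0 < eps by near: eps; exact: nbhs_right_gt.
(* The three exponentials undo the three logarithms applied to [|ln eps|]. *)
have lneps : ln eps < - expR (expR (expR A)).
  by rewrite -[X in _ < X]expRK ltr_ln ?posrE ?expR_gt0.
apply: ltW; rewrite /log3; do 3 apply: lt_ln_of_expR_lt.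
have ln0' : ln eps < 0 by rewrite (lt_trans lneps)// oppr_lt0 expR_gt0.
by rewrite ltr0_norm// ltrNr.
Unshelve. all: by end_near. Qed.

Lemma near_small_eps : \forall eps \near 0^'+, @small_eps R eps.
Proof.
near=> eps; split; last by near: eps; exact: cvgry_ge log3_cvg 1.
apply/andP; split; first by near: eps; exact: nbhs_right_gt.
by near: eps; exact: nbhs_right_le.
Unshelve. all: by end_near. Qed.

Lemma psi_cvg beta : 0 < beta -> psi beta eps @[eps --> 0^'+] --> +oo.
Proof.
move=> b0; apply/cvgryPge => A; near=> eps.
have l1 : Num.max A 1 `^ beta^-1 <= log3 eps by near: eps; exact: cvgry_ge log3_cvg _.
have m0 : 0 <= Num.max A 1 by rewrite le_max ler01 orbT.
apply: (@le_trans _ _ (Num.max A 1)); first by rewrite le_max lexx.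
have -> : Num.max A 1 = (Num.max A 1 `^ beta^-1) `^ beta.
  by rewrite -powRrM mulVf ?powRr1 ?lt0r_neq0.
apply: ge0_ler_powR => //; rewrite ?nnegrE ?powR_ge0 ?(ltW b0)//.
by apply: le_trans l1; exact: powR_ge0.
Unshelve. all: by end_near. Qed.

Lemma psiV_powR_cvg0 beta (a : R) : 0 < beta -> 0 < a ->
  (psi beta eps)^-1 `^ a @[eps --> 0^'+] --> (0 : R).
Proof.
move=> b0 a0; apply/cvgr0Pnorm_le => e e0; near=> eps.
have ea0 : 0 < e `^ a^-1 by rewrite powR_gt0.
have pe : (e `^ a^-1)^-1 <= psi beta eps by near: eps; exact: cvgry_ge (psi_cvg b0) _.
have p0 : 0 < psi beta eps by apply: lt_le_trans pe; rewrite invr_gt0.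
rewrite ger0_norm ?powR_ge0//.
have -> : e = (e `^ a^-1) `^ a by rewrite -powRrM mulVf ?lt0r_neq0// powRr1// ltW.
apply: ge0_ler_powR; rewrite ?nnegrE ?invr_ge0 ?(ltW p0) ?(ltW ea0) ?(ltW a0)//.
by rewrite -[leRHS]invrK lef_pV2 ?posrE ?invr_gt0.
Unshelve. all: by end_near. Qed.

(** If [ln (ln |ln eps|)] were not positive, the outer logarithm would take its default 0, against
    [1 <= log3 eps]. *)
Lemma small_eps_expR_log3 eps : small_eps eps -> ln (ln `|ln eps|) = expR (log3 eps).
Proof.
move=> [_ l1]; rewrite lnK// posrE ltNge; apply/negP => l0.
by move: l1; rewrite /log3 ln0// ler10.
Qed.

Lemma expR_ge_exprn (N : nat) (y : R) : 0 <= y -> (y / N.+1%:R) ^+ N.+1 <= expR y.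
Proof.
move=> y0; have -> : expR y = expR (y / N.+1%:R) ^+ N.+1.
  by rewrite -expRM_natl mulrC mulfVK// pnatr_eq0.
rewrite lerXn2r ?nnegrE ?expR_ge0 ?divr_ge0//.
by apply: le_trans (expR_ge1Dx _); rewrite lerDr.
Qed.

(* With [y = log3 eps], the quotient is [a * y `^ (beta * p) / expR y]. *)
Lemma psi_expn_div_cvg0 beta (a : R) (p : nat) : 0 < beta -> 0 <= a ->
  a * psi beta eps ^+ p / ln (ln `|ln eps|) @[eps --> 0^'+] --> (0 : R).
Proof.
move=> b0 a0; pose N := Num.bound (beta * p%:R).
have bN : beta * p%:R <= N%:R.
  by apply: ltW; apply: archi_boundP; rewrite mulr_ge0// ltW.
(* Since [psi ^+ p <= y ^+ N], the lower bound of degree [N.+1] for [expR y] leaves a spare factor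
   [y]; [C / e <= y] is what it must absorb. *)
pose C : R := a * N.+1%:R ^+ N.+1.
have C0 : 0 <= C by rewrite mulr_ge0// exprn_ge0.
apply/cvgr0Pnorm_le => e e0; near=> eps.
have se : small_eps eps by near: eps; exact: near_small_eps.
have l1 : 1 <= log3 eps by case: se.
have lC : C / e <= log3 eps by near: eps; exact: cvgry_ge log3_cvg _.
rewrite small_eps_expR_log3//; set y := log3 eps in l1 lC *.
have y0 : 0 < y by exact: lt_le_trans l1.
have psiN : psi beta eps ^+ p <= y ^+ N.
  rewrite /psi -/y -powR_mulrn ?powR_ge0// -powRrM -powR_mulrn ?(ltW y0)//.
  by apply: ler_powR.
rewrite ger0_norm; last first.
  by rewrite divr_ge0 ?expR_ge0// mulr_ge0// exprn_ge0// powR_ge0.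
rewrite ler_pdivrMr ?expR_gt0//.
apply: (@le_trans _ _ (e * (y / N.+1%:R) ^+ N.+1)); last first.
  by apply: ler_wpM2l; rewrite ?(ltW e0)// expR_ge_exprn// ltW.
apply: (@le_trans _ _ (a * y ^+ N)); first exact: ler_wpM2l.
rewrite expr_div_n mulrA ler_pdivlMr ?exprn_gt0//.
rewrite [in leRHS]exprS [leRHS]mulrA [leLHS]mulrAC -/C.
apply: ler_wpM2r; first by rewrite exprn_ge0 ?(ltW y0).
by move: lC; rewrite ler_pdivrMr// mulrC.
Unshelve. all: by end_near. Qed.

End limits.

(** * Assembly of the derivative bounds, the limits and the almost sure convergence *)

Unset Implicit Arguments.
Set Strict Implicit.

Theorem lemma4p1 (R : realType) (d : measure_display) (Omega : measurableType d)
    (P : probability Omega R) (w : R -> {RV P >-> R})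
    (hw : brownian_motion w)
    (beta : R) (hbeta : 0 < beta)
    (eta : R -> R) (eta_ge0 : forall x : R, 0 <= eta x)
    (eta_smooth : smooth eta)
    (eta_supp : closure [set x : R | eta x != 0] `<=` `]0, 1[)
    (eta_int : (\int[lebesgue_measure]_x (eta x)%:E = 1)%E)
    (n K : nat) (n1 : nat -> nat)
    (hK : (maxn (n + 2) 6 < K)%N) (hn1 : (0 < n1 K)%N) :
  let path := fun (omega : Omega) (t : R) => w t omega in
  let weps := fun (eps : R) (omega : Omega) =>
    w_eps beta eta (path omega) eps in
  let H := psi_bound beta eta (n1 K) in
  [/\ forall (eps : R) (omega : Omega), small_eps eps -> smooth (weps eps omega),
      forall (eps : R) (omega : Omega) (T : R), small_eps eps -> 0 < T ->
        (forall k : nat, (0 < k)%N ->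
          (Ck_norm `[0%R, T] k ((weps eps omega)^`())%classic <=
           (k%:R * fine (Ck_norm setT k.+2 eta) * psi beta eps ^+ k.+2)%:E)%E)
        /\ (Ck_norm `[0%R, T] 0 ((weps eps omega)^`())%classic <=
            (fine (Ck_norm setT 2 eta) * psi beta eps ^+ 2)%:E)%E,
      forall T : R, 0 < T ->
        [/\ forall eps : R, small_eps eps -> 1 <= H eps,
            forall eps : R, small_eps eps ->
              forall k : nat, (1 <= k <= (n1 K).+1)%N ->
              (ereal_sup [set `|((weps eps p.2)^`(k))%classic p.1|%R%:E | p in
                 [set p : R * Omega | `[0%R, T]%classic p.1]] <= (H eps)%:E)%E,
            H eps @[eps --> 0^'+] --> +oo
          & H eps ^+ (2 * n1 K) / ln (ln `|ln eps|) @[eps --> 0^'+] --> (0 : R)]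
    & forall T : R, 0 < T -> exists theta : R, 0 < theta < 1 / 2 /\
        {ae P, forall omega : Omega,
           holder_norm theta T (weps eps omega \- path omega)
             @[eps --> 0^'+] --> 0%E}].
Proof.
move=> path weps H; have [w0 cw _ _] := hw.
pose Y eps omega s := stopped (psi beta eps) (path omega) (Num.max s 0).
have psi1 eps : small_eps eps -> 1 <= psi beta eps by exact: psi_ge1.
have YP eps omega : small_eps eps ->
    continuous (Y eps omega) /\ forall s, `|Y eps omega s| <= psi beta eps.
  move=> /psi1 p1; have p0 := lt_le_trans ltr01 p1.
  by have [] := stopped_maxr0 p0 (w0 omega) (cw omega).
have wE eps omega : weps eps omega = conv (eta_scaled eta (psi beta eps)) (Y eps omega).
  by rewrite /weps w_eps_conv//; exact: w0.
pose N := fine (Ck_norm setT (n1 K).+2 eta).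
have N_sum : N = \sum_(i < (n1 K).+3) sup_norm eta i by rewrite /N Ck_norm_eta.
have le_N i : (i < (n1 K).+3)%N -> sup_norm eta i <= N.
  move=> iK; rewrite N_sum (bigD1 (Ordinal iK))//= lerDl.
  by apply: sumr_ge0 => j _; exact: sup_norm_ge0.
have N1 : 1 <= N.
  by apply: le_trans (le_N 0%N isT); exact: sup_norm0_ge1.
have n1N : 1 <= (n1 K)%:R * N.
  by rewrite -[leLHS]mulr1; apply: ler_pM => //; rewrite ler1n.
have HE eps : H eps = (n1 K)%:R * N * psi beta eps ^+ (n1 K).+2 by [].
have H_ge eps : small_eps eps -> psi beta eps ^+ (n1 K).+2 <= H eps.
  by move=> /psi1 p1; rewrite HE ler_peMl// exprn_ge0// (le_trans ler01).
split.
- move=> eps omega se; have [cY Yp] := YP eps omega se.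
  by rewrite wE; exact: (smooth_conv_eta eta_smooth eta_supp (psi1 _ se)).
- move=> eps omega T se T0; have [cY Yp] := YP eps omega se.
  have hCk k := Ck_norm_derive_conv_eta eta_smooth eta_supp (psi1 _ se) cY Yp k T.
  split; last by rewrite wE; exact: hCk.
  (* The factor [k] is at least 1 and only weakens the bound. *)
  move=> k k0; rewrite wE; apply: (le_trans (hCk k)); rewrite lee_fin -mulrA.
  apply: ler_peMl; last by rewrite ler1n.
  rewrite mulr_ge0 ?exprn_ge0 ?(le_trans ler01 (psi1 _ se))//.
  by rewrite Ck_norm_eta//= sumr_ge0// => i _; exact: sup_norm_ge0.
- move=> T T0; split.
  + by move=> eps se; apply: le_trans (H_ge _ se); rewrite exprn_ege1// psi1.
  + move=> eps se k /andP[k1 kn1]; apply: ge_ereal_sup => _ [[t omega] /= _ <-].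
    have [cY Yp] := YP eps omega se; have p1 := psi1 _ se.
    rewrite lee_fin wE.
    apply: (le_trans (norm_derive1n_conv_eta eta_smooth eta_supp p1 cY Yp k t)).
    rewrite HE; apply: ler_pM.
    * exact: sup_norm_ge0.
    * by rewrite exprn_ge0// (le_trans ler01).
    * apply: (le_trans (le_N k _)); first by rewrite ltnS (leq_trans kn1).
      by rewrite ler_peMl ?ler1n// (le_trans ler01).
    (* Order [k <= (n1 K).+1] gives the exponent [k.+1 <= (n1 K).+2]. *)
    * by apply: ler_weXn2l.
  + apply/cvgryPge => A; near=> eps.
    have se : small_eps eps by near: eps; exact: near_small_eps.
    have pA : A <= psi beta eps by near: eps; exact: cvgry_ge (psi_cvg hbeta) _.
    apply: (le_trans pA); apply: le_trans (H_ge _ se).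
    by rewrite exprS ler_peMr ?exprn_ege1 ?(le_trans ler01)// psi1.
  + have -> : (fun eps => H eps ^+ (2 * n1 K) / ln (ln `|ln eps|)) =
        (fun eps => ((n1 K)%:R * N) ^+ (2 * n1 K) *
          psi beta eps ^+ ((n1 K).+2 * (2 * n1 K)) / ln (ln `|ln eps|)).
      by apply/funext => eps; rewrite HE exprMn -exprM.
    by apply: psi_expn_div_cvg0 => //; rewrite exprn_ge0// (le_trans ler01).
(* Any exponent strictly below the path exponent [1 / 8] leaves a positive power of [psi^-1]. *)
- move=> T T0; exists 16^-1; split.
    by rewrite invr_gt0 ltr0n/= mul1r ltf_pV2 ?posrE// ltr_nat.
  pose M := Num.bound T; have TM : T <= M%:R by apply: ltW; apply: archi_boundP; exact: ltW.
  have := brownian_holder hw M; apply: filterS => omega [C C0 hC].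
  have hCT s t : 0 <= s <= T -> 0 <= t <= T ->
      `|path omega t - path omega s| <= C * `|t - s| `^ 8^-1.
    move=> /andP[s0 sT] /andP[t0 tT]; apply: hC.
      by rewrite s0 (le_trans sT).
    by rewrite t0 (le_trans tT).
  (* As the path starts at 0, its Hoelder constant bounds it on [[0, T]]; once [psi] exceeds this
     bound no stopping occurs before [T]. *)
  have xB s : 0 <= s <= T -> `|path omega s| <= C * T `^ 8^-1.
    move=> /andP[s0 sT]; have := hCT 0 s; rewrite lexx s0 sT (ltW T0) => /(_ isT isT).
    rewrite /path w0 !subr0 => /le_trans; apply; apply: ler_wpM2l => //.
    by apply: ge0_ler_powR; rewrite ?nnegrE ?invr_ge0// ?(ger0_norm s0)// ltW.
  have theta0 : (0 : R) < 16^-1 by rewrite invr_gt0.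
  have thetag : (16^-1 : R) < 8^-1 by rewrite ltf_pV2 ?posrE// ltr_nat.
  pose B eps : \bar R := (3 * C * (psi beta eps)^-1 `^ (8^-1 - 16^-1))%:E.
  have B0 : B eps @[eps --> 0^'+] --> 0%E.
    apply: cvg_EFin; first exact: nearW.
    rewrite -[X in _ --> X](mulr0 (3 * C)); apply: cvgMr.
    by apply: psiV_powR_cvg0; rewrite ?subr_gt0.
  apply: (squeeze_cvge _ (cvg_cst 0%E) B0); near=> eps.
  have se : small_eps eps by near: eps; exact: near_small_eps.
  rewrite holder_norm_ge0//=.
  have pB : C * T `^ 8^-1 < psi beta eps by near: eps; exact: cvgry_gt (psi_cvg hbeta) _.
  apply: (holder_norm_w_eps_le eta_ge0 eta_smooth eta_supp eta_int (w0 omega) (cw omega)) => //.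
  + exact: psi1.
  + by move=> s sT; apply: le_lt_trans pB; exact: xB.
Unshelve. all: by end_near. Qed.
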